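(* If $(t_k)$ and $(\tau_k)$, $k=0,1,2,\ldots$, are a binomial-transform pair of the first kind, then so are the sequences \[ a_k=\frac{1}{k+1}\sum_{j=0}^k\tau_j\quad\text{and}\quad \alpha_k=\frac{t_k}{k+1},\qquad k=0,1,2,\ldots. \]
   Context: Two sequences $(t_k)_{k\ge0}$ and $(\tau_k)_{k\ge0}$ of complex numbers form a binomial-transform pair of the first kind if $\tau_n=\sum_{k=0}^n(-1)^k\binom nk t_k$ for every non-negative integer $n$ (equivalently $t_n=\sum_{k=0}^n(-1)^k\binom nk\tau_k$ for every $n\ge0$). *)

(* Defs.v *)
From mathcomp Require Import all_boot all_order all_algebra.
From mathcomp Require Import complex reals.

Set Implicit Arguments.
Unset Strict Implicit.
Unset Printing Implicit Defensive.

Import GRing.Theory.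
Local Open Scope ring_scope.

Definition binomial_pair1 (R : realType) (t tau : nat -> R[i]) : Prop :=
  forall n : nat,
    tau n = \sum_(0 <= k < n.+1) (-1) ^+ k * 'C(n, k)%:R * t k.

(* Main.v *)
Require Import Defs.
From mathcomp Require Import all_boot all_order all_algebra.
From mathcomp Require Import complex reals.

Import GRing.Theory Num.Theory.

Local Open Scope ring_scope.

(** Write T for the binomial transform. Pascal's rule gives
    (T u)_n - (T u)_(n+1) = (T (shift u))_n, from which T is an involution.
    Applied to u = (0, t_0, t_1, ...), for which T (shift u) = tau, it also gives
    (T u)_n = - \sum_(j < n) tau_j. Since C(n,k) / (k+1) = C(n+1,k+1) / (n+1),
    the claim is the identity T (T u) = u at index n + 1, divided by n + 1. *)

Definition binomial_transform {R : pzRingType} (u : nat -> R) (n : nat) : R :=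
  \sum_(0 <= k < n.+1) (-1) ^+ k * 'C(n, k)%:R * u k.

Lemma binomial_transform0 (R : pzRingType) (u : nat -> R) :
  binomial_transform u 0 = u 0%N.
Proof. by rewrite /binomial_transform big_nat1 expr0 bin0 !mul1r. Qed.

Lemma eq_binomial_transform (R : pzRingType) (u v : nat -> R) :
  u =1 v -> binomial_transform u =1 binomial_transform v.
Proof. by move=> uv n; apply: eq_bigr => k _; rewrite uv. Qed.

Lemma binomial_transformB (R : pzRingType) (u v : nat -> R) (n : nat) :
  binomial_transform (fun k => u k - v k) n =
  binomial_transform u n - binomial_transform v n.
Proof. by rewrite -sumrB; apply: eq_bigr => k _; rewrite mulrBr. Qed.

Lemma binomial_transformS (R : pzRingType) (u : nat -> R) (n : nat) :
  binomial_transform u n.+1 =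
  binomial_transform u n - binomial_transform (u \o succn) n.
Proof.
(* The added term [k = n.+1] vanishes because ['C(n, n.+1)] is 0; the transforms at [n] and [n.+1]
   then have the same range. *)
have widen : binomial_transform u n =
    \sum_(0 <= k < n.+2) (-1) ^+ k * 'C(n, k)%:R * u k.
  by rewrite big_nat_recr //= bin_small // mulr0 mul0r addr0.
rewrite widen /binomial_transform big_nat_recl // [in RHS]big_nat_recl //.
rewrite !bin0 -addrA -sumrB; congr (_ + _); apply: eq_bigr => k _ /=.
by rewrite binS natrD mulrDr mulrDl exprS !mulN1r !mulNr.
Qed.

(** Induction on the index with [u] general: since T u - shift (T u) = T (shift u), index [n.+1] for
    [u] reduces to index [n] for its shift. *)
Lemma binomial_transformK (R : pzRingType) (u : nat -> R) :
  binomial_transform (binomial_transform u) =1 u.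
Proof.
move=> n; elim: n u => [|n IHn] u; first by rewrite !binomial_transform0.
rewrite binomial_transformS -binomial_transformB -[RHS](IHn (u \o succn)).
by apply: eq_binomial_transform => k; rewrite /= binomial_transformS subKr.
Qed.

Lemma binomial_transform_cons0 (R : pzRingType) (t : nat -> R) (n : nat) :
  binomial_transform (fun k => if k is i.+1 then t i else 0) n =
  - \sum_(0 <= j < n) binomial_transform t j.
Proof.
elim: n => [|n IHn]; first by rewrite binomial_transform0 big_nil oppr0.
by rewrite binomial_transformS IHn big_nat_recr //= opprD.
Qed.

Lemma divn_binS (F : numFieldType) (n k : nat) :
  'C(n, k)%:R / k.+1%:R = 'C(n.+1, k.+1)%:R / n.+1%:R :> F.
Proof.
apply/eqP; rewrite eqr_div ?pnatr_eq0 // -!natrM; apply/eqP; congr _%:R.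
by rewrite mulnC mul_bin_diag mulnC.
Qed.

Theorem theorem17 (R : realType) (t tau : nat -> R[i]) :
  binomial_pair1 t tau ->
  binomial_pair1
    (fun k : nat => 1 / k.+1%:R * \sum_(0 <= j < k.+1) tau j)
    (fun k : nat => t k / k.+1%:R).
Proof.
move=> pair n.
have := binomial_transformK _ (fun k => if k is i.+1 then t i else 0) n.+1.
rewrite (eq_binomial_transform _ _ _ (binomial_transform_cons0 _ t)) /= => <-.
(* The term at index 0 carries an empty partial sum, so only the indices [k.+1] remain. *)
rewrite {1}/binomial_transform [in LHS]big_nat_recl // big_nil oppr0 mulr0 add0r.
rewrite mulr_suml; apply: eq_bigr => k _.
rewrite -(eq_bigr _ (fun j _ => pair j)).
(* The minus sign of the partial sums cancels the extra factor -1 in [(-1) ^+ k.+1]. *)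
rewrite mulrN exprS mulN1r !mulNr opprK div1r !mulrA -[_ * _ / k.+1%:R]mulrA.
by rewrite divn_binS mulrA mulrAC.
Qed.
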